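(* Let $p\ge1$, $\lambda\in(0,1)$, $\beta_0\in\mathbb R^p\setminus\{0\}$, $\sigma_\epsilon>0$, let $f$ be the density of $\mathcal N(0,\sigma_\epsilon^2)$, and let $X\sim\mathcal N(\mu_X,\Sigma_X)$ with $\mu_X\ne0$ and $\Sigma_X$ positive definite, with density $f^X$; let $f^Y(y)=\int f(y-\beta_0^\top x)f^X(x)dx$. Define $$\Gamma_1=\int\frac{\big(\int xf'(y-\beta_0^\top x)f^X(x)dx\big)\big(\int x^\top f'(y-\beta_0^\top x)f^X(x)dx\big)}{f^Y(y)}\,dy,$$ $$\Gamma_2=\int\Big(\int\frac{f(y-\beta_0^\top x)\int zf'(y-\beta_0^\top z)f^X(z)dz}{f^Y(y)}dy\Big)\Big(\int\frac{f(y-\beta_0^\top x)\int z^\top f'(y-\beta_0^\top z)f^X(z)dz}{f^Y(y)}dy\Big)f^X(x)\,dx,$$ $\Sigma_2=\big(\int (f'(t))^2/f(t)\,dt\big)\mathbb E[XX^\top]$, $\Sigma_{\mathrm{OLS}}=\Sigma_2^{-1}$, $$\tilde\Sigma_{\mathrm{SSL}}=\Big(\tfrac1\lambda\Gamma_1+\Sigma_2\Big)^{-1}\Big(\tfrac1\lambda(\Gamma_1+\Gamma_2)+\Sigma_2\Big)\Big(\tfrac1\lambda\Gamma_1+\Sigma_2\Big)^{-1},\qquad G=\Big(\sqrt{\det\tilde\Sigma_{\mathrm{SSL}}/\det\Sigma_{\mathrm{OLS}}}\Big)^{-1}.$$ Put $\zeta=\frac{\mu_X^\top\beta_0}{\sqrt{\beta_0^\top\Sigma_X\beta_0}\sqrt{\mu_X^\top\Sigma_X^{-1}\mu_X}}$,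 $\rho=\frac{1}{\mu_X^\top\Sigma_X^{-1}\mu_X}$, $\eta=\frac{\beta_0^\top\Sigma_X\beta_0}{\sigma_\epsilon^2}$. Then the maximizer of $\beta\mapsto\sum_{k=1}^m\log f(Y_k-\beta^\top X_k)$ coincides with the ordinary least squares estimator, and $$G=\frac{1+\frac1\lambda\Big(\frac{1}{1+\eta}\frac{1}{1+\rho}+\frac{2\eta}{(\eta+1)^2}\big(1-\frac{\zeta^2}{1+\rho}\big)\Big)+\frac{1}{\lambda^2}\frac{1-\zeta^2}{1+\rho}\frac{2\eta}{(\eta+1)^3}}{\sqrt{1+\frac1\lambda\Big(\frac{1}{1+\eta}\frac{1}{1+\rho}\big(1+\frac{\eta}{\eta+1}\big)+\frac{2\eta}{(\eta+1)^2}\big(1-\frac{\zeta^2}{1+\rho}\big)\big(1+\frac{\eta^2}{(\eta+1)^2}\big)\Big)+\frac{1}{\lambda^2}\frac{1-\zeta^2}{1+\rho}\frac{2\eta}{(\eta+1)^3}\big(1+\frac{\eta^2}{(\eta+1)^2}\big)\big(1+\frac{\eta}{\eta+1}\big)}}.$$ If instead $\mu_X=0$ (and otherwise the same setting), then $$G=\frac{1+\frac2\lambda\frac{\eta}{(\eta+1)^2}}{\sqrt{1+\frac2\lambda\Big(\frac{\eta}{(\eta+1)^2}+\frac{\eta^3}{(\eta+1)^4}\Big)}}.$$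
   Context: Here $(X_k,Y_k)$ are pairs from the linear model $Y=\beta_0^\top X+\epsilon$ with $\epsilon\sim\mathcal N(0,\sigma_\epsilon^2)$ independent of $X$. $G$ is the ''statistical gain'': the inverse ratio of the volumes of asymptotic confidence ellipsoids of the semi-supervised estimator (combining $m$ matched pairs and $n$ unmatched observations with $m/n\to\lambda$) and of the matched-sample maximum likelihood estimator. *)

(* Defs.v *)
From HB Require Import structures.
From mathcomp Require Import all_boot all_order all_algebra.
From mathcomp Require Import all_classical all_reals all_analysis.
Set Implicit Arguments.
Unset Strict Implicit.
Unset Printing Implicit Defensive.
Import Order.TTheory GRing.Theory Num.Theory.
Import numFieldNormedType.Exports.
Local Open Scope ring_scope.

Section Defs.
Variable R : realType.

Definition Rint (g : R -> R) : R := Rintegral (@lebesgue_measure R) setT g.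

(** Lebesgue integral over R^n, realised as the iterated (Fubini) integral
    over the first n coordinates; coordinates >= n are set to 0. *)
Definition cons_seq (t : R) (x : nat -> R) : nat -> R :=
  fun i => if i is i'.+1 then x i' else t.

Fixpoint iter_int (n : nat) (F : (nat -> R) -> R) : R :=
  match n with
  | 0 => F (fun _ => 0)
  | n'.+1 => Rint (fun t => iter_int n' (fun x => F (cons_seq t x)))
  end.

Definition Rint_vec (p : nat) (g : 'cV[R]_p -> R) : R :=
  iter_int p (fun x => g (\col_(i < p) x (nat_of_ord i))).

Definition Rint_vec_cV (p q : nat) (g : 'cV[R]_p -> 'cV[R]_q) : 'cV[R]_q :=
  \col_(i < q) Rint_vec (fun x => g x i ord0).
Definition Rint_vec_M (p q r : nat) (g : 'cV[R]_p -> 'M[R]_(q, r)) : 'M[R]_(q, r) :=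
  \matrix_(i < q, j < r) Rint_vec (fun x => g x i j).
Definition Rint_cV (q : nat) (g : R -> 'cV[R]_q) : 'cV[R]_q :=
  \col_(i < q) Rint (fun y => g y i ord0).
Definition Rint_M (q r : nat) (g : R -> 'M[R]_(q, r)) : 'M[R]_(q, r) :=
  \matrix_(i < q, j < r) Rint (fun y => g y i j).

Definition dotv (p : nat) (u v : 'cV[R]_p) : R := (u^T *m v) ord0 ord0.

Definition posdef (p : nat) (S : 'M[R]_p) : Prop :=
  S^T = S /\ forall v : 'cV[R]_p, v != 0 -> 0 < dotv v (S *m v).

Definition mvn_pdf (p : nat) (mu : 'cV[R]_p) (S : 'M[R]_p) (x : 'cV[R]_p) : R :=
  (Num.sqrt ((pi *+ 2) ^+ p * \det S))^-1 *
  expR (- (dotv (x - mu) (invmx S *m (x - mu))) / 2).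

Definition fnoise (s : R) : R -> R := normal_pdf 0 s.
Definition fnoise' (s : R) : R -> R := derive1 (fnoise s).

Section Model.
Variables (p : nat) (beta0 mu : 'cV[R]_p) (S : 'M[R]_p) (s lam : R).

Definition fX := mvn_pdf mu S.
Definition fY (y : R) : R := Rint_vec (fun x => fnoise s (y - dotv beta0 x) * fX x).

Definition hvec (y : R) : 'cV[R]_p :=
  Rint_vec_cV (fun x => (fnoise' s (y - dotv beta0 x) * fX x) *: x).

Definition Gamma1 : 'M[R]_p :=
  Rint_M (fun y => (fY y)^-1 *: (hvec y *m (hvec y)^T)).

Definition vvec (x : 'cV[R]_p) : 'cV[R]_p :=
  Rint_cV (fun y => (fnoise s (y - dotv beta0 x) / fY y) *: hvec y).

Definition Gamma2 : 'M[R]_p :=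
  Rint_vec_M (fun x => fX x *: (vvec x *m (vvec x)^T)).

Definition EXXt : 'M[R]_p := Rint_vec_M (fun x => fX x *: (x *m x^T)).

Definition Sigma2 : 'M[R]_p :=
  Rint (fun t => (fnoise' s t) ^+ 2 / fnoise s t) *: EXXt.

Definition Sigma_OLS : 'M[R]_p := invmx Sigma2.

Definition Amat : 'M[R]_p := lam^-1 *: Gamma1 + Sigma2.
Definition Bmat : 'M[R]_p := lam^-1 *: (Gamma1 + Gamma2) + Sigma2.

Definition Sigma_SSL : 'M[R]_p := invmx Amat *m Bmat *m invmx Amat.

Definition gain : R := (Num.sqrt (\det Sigma_SSL / \det Sigma_OLS))^-1.

End Model.

Definition loglik (p m : nat) (s : R) (X : 'I_m -> 'cV[R]_p) (Y : 'I_m -> R)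
  (b : 'cV[R]_p) : R :=
  \sum_(k < m) ln (fnoise s (Y k - dotv b (X k))).

Definition rss (p m : nat) (X : 'I_m -> 'cV[R]_p) (Y : 'I_m -> R)
  (b : 'cV[R]_p) : R :=
  \sum_(k < m) (Y k - dotv b (X k)) ^+ 2.

Definition is_MLE (p m : nat) (s : R) X Y (b : 'cV[R]_p) : Prop :=
  forall b' : 'cV[R]_p, @loglik p m s X Y b' <= loglik s X Y b.

Definition is_OLS (p m : nat) X Y (b : 'cV[R]_p) : Prop :=
  forall b' : 'cV[R]_p, @rss p m X Y b <= rss X Y b'.

End Defs.

(* Main.v *)
(** Write c = S b, t2 = b^T S b, V = s^2 + t2 and m = b^T mu.  Since Y ~ N(m, V) and
    X | Y = y is Gaussian, Bayes' formula gives hvec and vvec in closed form, and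
    Gaussian moments of order at most four give
      Gamma1 = mu mu^T / V + 2 c c^T / V^2,
      Gamma2 = (t2 / V^2) mu mu^T + (2 t2^2 / V^4) c c^T,
      EXXt = S + mu mu^T.
    All the determinants in the gain are then those of S perturbed by multiples of
    mu mu^T and c c^T, and the matrix determinant lemma evaluates them. *)

(* Over R^p the integral is an iterated one, so linearity in dimension [p] would cost integrability
   of every inner integral. The proof avoids it: each integrand is rewritten pointwise into one
   polynomial-times-Gaussian shape, and the integral of that shape is evaluated as a whole, from the
   innermost coordinates outwards. Integrability is then needed on the line only, where integration
   by parts yields the moments. The computation is parametrised by precision matrices: completing
   the square in a block of the precision splits off one coordinate, with a Schur complement as the
   remaining precision, and conditioning on Y merely adds the rank-one term b b^T / s^2. *)
From Pilot Require Import Defs.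
From HB Require Import structures.
From mathcomp Require Import all_boot all_order all_algebra.
From mathcomp Require Import all_classical all_reals all_analysis.
From mathcomp Require Import ring lra measurable_realfun.
Set Implicit Arguments.
Unset Strict Implicit.
Unset Printing Implicit Defensive.
Import Order.TTheory GRing.Theory Num.Theory.
Import numFieldNormedType.Exports.
Local Open Scope ring_scope.
(* Num.Rint, the predicate of integers, shadows the integral of Defs. *)
Local Notation Rint := Pilot.Defs.Rint.

(** * One-dimensional Gaussian moments *)

Section Dim1.
Local Open Scope classical_set_scope.
Local Open Scope ring_scope.
Context (R : realType).
Local Notation leb := (@lebesgue_measure R).
Local Notation integrable1 f := (leb.-integrable setT (EFin \o f)).

(** The last hypothesis forces F to decay like 1/|t - m|, so the boundary terms at [m - n.+1%:R] and
    [m + n.+1%:R] in the fundamental theorem of calculus vanish in the limit. Dominated convergence,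
    with bound |f|, passes from these intervals to the line. *)
Lemma Rint_derive_eq0 (F f : R -> R) (m C : R) :
  continuous f -> integrable1 f -> (forall t : R, is_derive t 1 F (f t)) ->
  (forall t, `|F t| * `|t - m| <= C) -> Rint f = 0.
Proof.
move=> cf intf dF FC.
pose D n := `[m - n.+1%:R, m + n.+1%:R]%classic : set R.
have mD n : @measurable _ (measurableTypeR R) (D n) by exact: measurable_itv.
pose f_ (n : nat) := (EFin \o f) \_ (D n).
have FTC n : (\int[leb]_x f_ n x = (F (m + n.+1%:R) - F (m - n.+1%:R))%:E)%E.
  rewrite -integral_mkcond EFinB (@continuous_FTC2 _ f F) //.
  - have : 0 < n.+1%:R :> R by rewrite ltr0n.
    lra.
  - exact: continuous_subspaceT.
  - split.
    + by move=> x _; have [] := dF x.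
    + by apply: cvg_at_right_filter; apply/differentiable_continuous/derivable1_diffP; have [] := dF (m - n.+1%:R).
    + by apply: cvg_at_left_filter; apply/differentiable_continuous/derivable1_diffP; have [] := dF (m + n.+1%:R).
  - by move=> x _; rewrite derive1E; have [_ ->] := dF x.
have /integrableP[mf _] := intf.
have [|//| | | |_ _] := @dominated_convergence _ _ R leb setT measurableT f_ (fun x => (f x)%:E) (fun x => `|(f x)%:E|%E).
- move=> n; have h := integrableS measurableT (mD n) (@subsetT _ _) intf.
  by case/integrableP: (proj1 (@integrable_mkcond _ _ R leb (D n) (EFin \o f) (mD n)) h).
- apply: aeW => x _; apply: cvg_near_cst.
  near=> n; rewrite /f_ patchE ifT // inE /D /= in_itv /=.
  have : `|x - m| <= n%:R by near: n; exact: nbhs_infty_ger.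
  rewrite ler_norml => /andP[h1 h2]; rewrite -natr1.
  by apply/andP; split; lra.
- exact: integrable_abse.
- apply: aeW => x n _; rewrite /f_ patchE; case: ifP => //= _.
  by rewrite normr0 lee_fin.
under eq_fun do rewrite FTC.
have F0 : (F (m + n.+1%:R) - F (m - n.+1%:R)) @[n --> \oo] --> (0 : R).
  have bnd n : `|F (m + n.+1%:R) - F (m - n.+1%:R)| <= C *+ 2 * n.+1%:R^-1.
    have := FC (m + n.+1%:R); have := FC (m - n.+1%:R).
    have -> : m - n.+1%:R - m = - n.+1%:R by ring.
    have -> : m + n.+1%:R - m = n.+1%:R by ring.
    rewrite normrN [`|n.+1%:R|]ger0_norm ?ler0n // => h1 h2.
    have n0 : 0 < n.+1%:R :> R by rewrite ltr0n.
    rewrite ler_pdivlMr //; apply: le_trans (_ : (`|F (m + n.+1%:R)| + `|F (m - n.+1%:R)|) * n.+1%:R <= _).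
      by rewrite ler_pM2r // ler_normB.
    by rewrite mulrDl mulr2n lerD.
  apply/norm_cvg0P; apply: (@squeeze_cvgr _ _ _ _ (cst 0) (fun n : nat => C *+ 2 * n.+1%:R^-1)).
  - by apply: nearW => n; rewrite normr_ge0 bnd.
  - exact: cvg_cst.
  - rewrite -[X in _ --> X](mulr0 (C *+ 2)); apply: cvgM; first exact: cvg_cst.
    exact: cvg_harmonic.
move=> h; have h2 : (F (m + n.+1%:R) - F (m - n.+1%:R))%:E @[n --> \oo] --> (0 : \bar R)%E.
  by apply/fine_cvgP; split; [exact: nearW|exact: F0].
rewrite /Rint /Rintegral.
by rewrite -[LHS]/(fine (\int[leb]_x (EFin \o f) x)%E) (cvg_unique _ h h2).
Unshelve. all: by end_near.
Qed.

(** Unnormalised Gaussian with precision [k] (inverse variance), the scalar case of the form used in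
    dimension [p]. *)
Definition gauss_weight (k m t : R) := expR (- (k * (t - m) ^+ 2) / 2).

Lemma sqr_gauss_weight_le (k u : R) : 0 < k -> u ^+ 2 * expR (- (k * u ^+ 2)) <= k^-1.
Proof.
move=> k0; rewrite expRN ler_pdivrMr ?expR_gt0 // mulrC ler_pdivlMr //.
rewrite mulrC; apply: le_trans (expR_ge1Dx _) .
by rewrite lerDr.
Qed.

(** The exponential is split into n+1 equal factors, each absorbing one u^2. This covers |u| > 1,
    where |u|^n is at most |u|^(2(n+1)); for |u| at most 1 the product is at most 1. The constant is
    the sum of the two bounds. *)
Lemma exprM_gauss_bounded (k : R) (n : nat) : 0 < k ->
  exists C, forall u, `|u| ^+ n * expR (- (k * u ^+ 2)) <= C.
Proof.
move=> k0; pose j := k / n.+1%:R.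
have j0 : 0 < j by rewrite divr_gt0.
exists (1 + j^-1 ^+ n.+1) => u.
have -> : k = j * n.+1%:R by rewrite divfK.
have e : expR (- (j * n.+1%:R * u ^+ 2)) = expR (- (j * u ^+ 2)) ^+ n.+1.
  by rewrite -expRM_natl; congr expR; ring.
have [u1|u1] := lerP `|u| 1.
  rewrite ler_wpDr ?exprn_ge0 ?invr_ge0 ?(ltW j0) //.
  rewrite mulr_ile1 ?exprn_ge0 ?expR_ge0 ?exprn_ile1 //.
  rewrite -[leRHS]expR0 ler_expR oppr_le0; apply: mulr_ge0 (sqr_ge0 _).
  by apply: mulr_ge0; [exact: ltW|exact: ler0n].
apply: le_trans (_ : j^-1 ^+ n.+1 <= _); last by rewrite lerDr.
apply: le_trans (_ : (u ^+ 2) ^+ n.+1 * expR (- (j * n.+1%:R * u ^+ 2)) <= _).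
  rewrite ler_pM2r ?expR_gt0 // -[u ^+ 2](real_normK (num_real _)) -exprM ler_weXn2l ?(ltW u1) //.
  by rewrite mul2n -addnn (leq_trans (leqnSn n)) ?leq_addr.
rewrite e -exprMn; apply: lerXn2r; rewrite ?nnegrE.
- exact: mulr_ge0 (sqr_ge0 _) (expR_ge0 _).
- by rewrite invr_ge0 ltW.
- exact: sqr_gauss_weight_le.
Qed.

Lemma gauss_weight_normal (k m : R) : 0 < k ->
  gauss_weight k m = fun t => Num.sqrt (pi *+ 2 / k) * normal_pdf m (Num.sqrt k^-1) t.
Proof.
move=> k0; have k1 : 0 < k^-1 by rewrite invr_gt0.
apply/funext => t; rewrite normal_pdfE ?gt_eqF ?sqrtr_gt0 //.
rewrite /normal_peak /normal_fun sqr_sqrtr ?(ltW k1) //.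
rewrite mulrnAl [k^-1 * pi]mulrC mulVKf.
  by rewrite /gauss_weight; congr expR; field; rewrite gt_eqF.
by rewrite sqrtr_eq0 -ltNge mulrn_wgt0 // divr_gt0 // pi_gt0.
Qed.

Lemma integrable_gauss_weight (k m : R) : 0 < k -> integrable1 (gauss_weight k m).
Proof.
move=> k0; rewrite gauss_weight_normal //.
apply: (@eq_integrable _ _ _ leb setT _ (fun t => (Num.sqrt (pi *+ 2 / k))%:E * (normal_pdf m (Num.sqrt k^-1) t)%:E)%E) => //.
by apply: integrableZl => //; exact: integrable_normal_pdf.
Qed.

Lemma Rint_gauss_weight (k m : R) : 0 < k -> Rint (gauss_weight k m) = Num.sqrt (pi *+ 2 / k).
Proof.
move=> k0; rewrite gauss_weight_normal // /Rint RintegralZl //; last exact: integrable_normal_pdf.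
by rewrite /Rintegral integral_normal_pdf mulr1.
Qed.

(** The derivative combines the monomials of degree n-1 and n+1, which makes it a recurrence between
    moments. At n = 0 the coefficient [n%:R] cancels the term with the truncated predecessor. *)
Lemma is_derive_monomial_gauss (k m : R) n (t : R) :
  is_derive t 1 (fun t : R => (t - m) ^+ n * gauss_weight k m t)
    (n%:R * ((t - m) ^+ n.-1 * gauss_weight k m t)
     - k * ((t - m) ^+ n.+1 * gauss_weight k m t)).
Proof.
have d1 : is_derive t 1 (fun t : R => t - m) 1.
  by apply: is_derive_eq; rewrite subr0.
have dX j : is_derive t 1 (fun t : R => (t - m) ^+ j) (j%:R * (t - m) ^+ j.-1).
  rewrite -(exprfctE (fun t => t - m)); apply: is_derive_eq (is_deriveX j d1) _.
  exact: mulr1.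
have dq : is_derive t 1 (fun t : R => - (k * (t - m) ^+ 2) / 2) (- (k * (t - m))).
  have -> : (fun t : R => - (k * (t - m) ^+ 2) / 2) = (- k / 2) \*: (fun t : R => (t - m) ^+ 2).
    by apply/funext => x /=; rewrite -[RHS]/(_ * _); field.
  apply: is_derive_eq (is_deriveZ (- k / 2) (dX 2)) _.
  by rewrite -[LHS]/(_ * (_ * _)); field.
have de : is_derive t 1 (gauss_weight k m) (- (k * (t - m)) * gauss_weight k m t).
  apply: is_derive_eq (is_derive1_comp (is_derive_expR _) dq) _.
  by rewrite mulrC.
apply: is_derive_eq (is_deriveM (dX n) de) _.
rewrite -[LHS]/(_ * _ + _ * _) exprS; ring.
Qed.

Lemma continuous_monomial_gauss (k m : R) n :
  continuous (fun t : R => (t - m) ^+ n * gauss_weight k m t).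
Proof.
move=> x; apply/differentiable_continuous/derivable1_diffP.
by have [] := is_derive_monomial_gauss k m n x.
Qed.

Lemma integrable_monomial_gauss (k m : R) n : 0 < k ->
  integrable1 (fun t => (t - m) ^+ n * gauss_weight k m t).
Proof.
(* With u = t - m, the weight exp(-k u^2/2) is two copies of exp(-(k/4) u^2): one bounds the power,
   the other is the integrable [gauss_weight (k / 2) m]. *)
move=> k0; have k4 : 0 < k / 4 by rewrite divr_gt0.
have [C hC] := exprM_gauss_bounded n k4.
have k2 : 0 < k / 2 by rewrite divr_gt0.
apply: (@le_integrable _ _ _ leb setT _ _ (fun t => C%:E * (gauss_weight (k / 2) m t)%:E)%E) => //.
- apply/measurable_EFinP; apply: continuous_measurable_fun; exact: continuous_monomial_gauss.
- move=> t _ /=; rewrite lee_fin !normrM normrX [X in _ * X <= _]ger0_norm ?expR_ge0 //.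
  rewrite [X in _ <= _ * X]ger0_norm ?expR_ge0 //.
  have -> : gauss_weight k m t = expR (- (k / 4 * (t - m) ^+ 2)) * gauss_weight (k / 2) m t.
    by rewrite /gauss_weight -expRD; congr expR; field.
  rewrite mulrA ler_pM2r ?expR_gt0 //; apply: le_trans (hC _) (ler_norm _).
- by apply: integrableZl => //; exact: integrable_gauss_weight.
Qed.

Lemma monomial_gauss_bounded (k m : R) n : 0 < k ->
  exists C, forall t, `|(t - m) ^+ n * gauss_weight k m t| * `|t - m| <= C.
Proof.
move=> k0; have k2 : 0 < k / 2 by rewrite divr_gt0.
have [C hC] := exprM_gauss_bounded n.+1 k2; exists C => t.
rewrite normrM normrX [X in _ * X * _]ger0_norm ?expR_ge0 // mulrAC -exprSr.
have -> : gauss_weight k m t = expR (- (k / 2 * (t - m) ^+ 2)).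
  by congr expR; field.
exact: hC.
Qed.

Lemma Rint_monomial_gauss_rec (k m : R) n : 0 < k ->
  k * Rint (fun t => (t - m) ^+ n.+1 * gauss_weight k m t)
  = n%:R * Rint (fun t => (t - m) ^+ n.-1 * gauss_weight k m t).
Proof.
move=> k0; have [C hC] := monomial_gauss_bounded m n k0.
have i1 j := integrable_monomial_gauss m j k0.
have iZ c j : integrable1 (fun t => c * ((t - m) ^+ j * gauss_weight k m t)).
  exact: (@integrableZl _ _ _ leb setT measurableT c _ (i1 j)).
have /eqP : Rint (fun t => n%:R * ((t - m) ^+ n.-1 * gauss_weight k m t)
    - k * ((t - m) ^+ n.+1 * gauss_weight k m t)) = 0.
  apply: (@Rint_derive_eq0 (fun t => (t - m) ^+ n * gauss_weight k m t) _ m C) => //.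
  - by move=> x; apply: cvgB; apply: cvgM (@continuous_monomial_gauss _ _ _ _); exact: cvg_cst.
  - exact: (@integrableB _ _ _ leb setT measurableT _ _ (iZ _ _) (iZ _ _)).
  - by move=> t; exact: is_derive_monomial_gauss.
by rewrite /Rint RintegralB // !RintegralZl // subr_eq0 => /eqP <-.
Qed.

Lemma Rint_quartic_gauss (k m c0 c1 c2 c3 c4 : R) : 0 < k ->
  Rint (fun t => (c0 + c1 * (t - m) + c2 * (t - m) ^+ 2 + c3 * (t - m) ^+ 3 + c4 * (t - m) ^+ 4)
                 * gauss_weight k m t)
  = (c0 + c2 / k + 3 * c4 / k ^+ 2) * Num.sqrt (pi *+ 2 / k).
Proof.
move=> k0; have kN0 : k != 0 by rewrite gt_eqF.
have i1 j := integrable_monomial_gauss m j k0.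
have iZ c j : integrable1 (fun t => c * ((t - m) ^+ j * gauss_weight k m t)).
  exact: (@integrableZl _ _ _ leb setT measurableT c _ (i1 j)).
have iD (f g : R -> R) : integrable1 f -> integrable1 g -> integrable1 (fun t => f t + g t).
  move=> hf hg; exact: (@integrableD _ _ _ leb setT measurableT _ _ hf hg).
pose M j := Rint (fun t => (t - m) ^+ j * gauss_weight k m t).
have M0 : M 0%N = Num.sqrt (pi *+ 2 / k).
  by rewrite -(Rint_gauss_weight m k0); congr Rint; apply/funext => t; rewrite expr0 mul1r.
have MS j : M j.+1 = k^-1 * (j%:R * M j.-1).
  by rewrite /M -Rint_monomial_gauss_rec // mulKf.
transitivity (c0 * M 0%N + c1 * M 1%N + c2 * M 2%N + c3 * M 3%N + c4 * M 4%N).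
  have i2 := iD _ _ (iZ c0 0%N) (iZ c1 1%N).
  have i3 := iD _ _ i2 (iZ c2 2%N); have i4 := iD _ _ i3 (iZ c3 3%N).
  rewrite /M /Rint -!RintegralZl // -!RintegralD //.
  by apply: eq_Rintegral => t _; rewrite expr0; ring.
(* The recurrence at j = 0 gives M 1 = 0, hence M 3 = 0; the factor 3 comes from M 4 = 3 M 2 / k. *)
by rewrite !(MS, M0) /=; field.
Qed.
End Dim1.

(** * Calculus of the scalar product *)

Section Dotv.
Context (R : realType).

Lemma dotvE p (u v : 'cV[R]_p) : dotv u v = \sum_i u i 0 * v i 0.
Proof. by rewrite /dotv mxE; apply: eq_bigr => i _; rewrite mxE. Qed.

Lemma dotvC p (u v : 'cV[R]_p) : dotv u v = dotv v u.
Proof. by rewrite !dotvE; apply: eq_bigr => i _; rewrite mulrC. Qed.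

Lemma dotvDl p (u v w : 'cV[R]_p) : dotv (u + v) w = dotv u w + dotv v w.
Proof. by rewrite /dotv linearD mulmxDl mxE. Qed.

Lemma dotvDr p (u v w : 'cV[R]_p) : dotv w (u + v) = dotv w u + dotv w v.
Proof. by rewrite ![dotv w _]dotvC dotvDl. Qed.

Lemma dotvZl p a (u v : 'cV[R]_p) : dotv (a *: u) v = a * dotv u v.
Proof. by rewrite /dotv linearZ /= -scalemxAl mxE. Qed.

Lemma dotvZr p a (u v : 'cV[R]_p) : dotv u (a *: v) = a * dotv u v.
Proof. by rewrite dotvC dotvZl dotvC. Qed.

Lemma dotvNl p (u v : 'cV[R]_p) : dotv (- u) v = - dotv u v.
Proof. by rewrite -scaleN1r dotvZl mulN1r. Qed.

Lemma dotvNr p (u v : 'cV[R]_p) : dotv u (- v) = - dotv u v.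
Proof. by rewrite dotvC dotvNl dotvC. Qed.

Lemma dotv0l p (v : 'cV[R]_p) : dotv 0 v = 0.
Proof. by rewrite -(scale0r 0) dotvZl mul0r. Qed.

Lemma dotv_mulmx p q (M : 'M[R]_(p, q)) (u : 'cV[R]_p) (v : 'cV[R]_q) :
  dotv u (M *m v) = dotv (M^T *m u) v.
Proof. by rewrite /dotv trmx_mul trmxK mulmxA. Qed.

Lemma dotv_col_mx p q (a c : 'cV[R]_p) (b d : 'cV[R]_q) :
  dotv (col_mx a b) (col_mx c d) = dotv a c + dotv b d.
Proof. by rewrite /dotv tr_col_mx mul_row_col mxE. Qed.

Lemma dotv_scalar_mx (a b : R) : dotv (a%:M : 'cV[R]_1) b%:M = a * b.
Proof. by rewrite /dotv tr_scalar_mx -scalar_mxM mxE eqxx. Qed.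

Definition dotvE_lin := (dotvDl, dotvDr, dotvNl, dotvNr, dotvZl, dotvZr).

Lemma sym_block_mx p (K : 'M[R]_(1 + p)) : K^T = K ->
  exists (a : R) (k : 'cV[R]_p) (K2 : 'M[R]_p), K = block_mx (a%:M : 'M[R]_1) (k^T) k K2 /\ K2^T = K2.
Proof.
move=> KT; exists (ulsubmx K 0 0), (dlsubmx K), (drsubmx K).
by rewrite -mx11_scalar trmx_dlsub trmx_drsub KT submxK.
Qed.

End Dotv.

(** * Schur complement of a scalar corner *)

Section Schur.
Context (R : realType) (p : nat).
Variables (a : R) (k : 'cV[R]_p) (K2 : 'M[R]_p).
Let K : 'M[R]_(1 + p) := block_mx a%:M (k^T) k K2.
Let b := invmx K2 *m k.
(** If [K] is a precision matrix, this is the marginal precision of the first coordinate. *)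
Definition schur := a - dotv k (invmx K2 *m k).

Lemma mul_block_col_mx (t : R) (y : 'cV[R]_p) :
  K *m col_mx t%:M y = col_mx (a * t + dotv k y)%:M (t *: k + K2 *m y).
Proof.
rewrite /K mul_block_col -scalar_mxM -mul_mx_scalar; congr col_mx.
by rewrite [X in _ + X]mx11_scalar -raddfD.
Qed.

Lemma posdef_block_corner : posdef K -> posdef K2.
Proof.
case=> KT Kpos; split.
  by move: KT; rewrite /K tr_block_mx => /eq_block_mx[].
move=> v v0; have := Kpos (col_mx 0%:M v).
rewrite mul_block_col_mx dotv_col_mx dotv_scalar_mx mul0r add0r scale0r add0r; apply.
by apply: contra v0 => /eqP/(congr1 dsubmx); rewrite col_mxKd linear0 => ->.
Qed.

Hypotheses (K2T : K2^T = K2) (K2u : K2 \in unitmx).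

Lemma posdef_schur_gt0 : posdef K -> 0 < schur.
Proof.
(* The vector (1, -b) minimises the quadratic form among those with first coordinate 1, and the
   minimum is [schur]. *)
case=> KT Kpos; have := Kpos (col_mx 1%:M (- b)).
rewrite mul_block_col_mx dotv_col_mx dotv_scalar_mx scale1r mulmxN mulKVmx //.
rewrite subrr [dotv _ 0]dotvC dotv0l addr0 mul1r mulr1 dotvNr; apply.
apply/eqP => /(congr1 usubmx); rewrite col_mxKu linear0 => /matrixP/(_ 0 0)/eqP.
by rewrite !mxE eqxx oner_eq0.
Qed.

Lemma det_schur : \det K = schur * \det K2.
Proof.
have -> : K = block_mx 1%:M b^T 0 1%:M *m block_mx (schur%:M : 'M[R]_1) 0 k K2.
  rewrite mulmx_block !mul1mx !mul0mx !add0r; congr block_mx.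
    rewrite [b^T *m k]mx11_scalar -/(dotv b k) dotvC -raddfD /=; congr (_%:M).
    by rewrite /schur addrNK.
  by rewrite /b trmx_mul trmx_inv K2T mulmxKV.
by rewrite det_mulmx det_ublock det_lblock !det1 !mul1r det_scalar1.
Qed.

(** Completing the square in y: given a centred first coordinate t, the others have precision [K2]
    and mean -t b. *)
Lemma dotv_schur (t : R) (y : 'cV[R]_p) :
  dotv (col_mx t%:M y) (K *m col_mx t%:M y) =
  schur * t ^+ 2 + dotv (y + t *: b) (K2 *m (y + t *: b)).
Proof.
rewrite mul_block_col_mx dotv_col_mx dotv_scalar_mx mulmxDr -scalemxAr mulKVmx //.
have h : dotv b (K2 *m y) = dotv k y by rewrite dotv_mulmx K2T mulKVmx.
rewrite !dotvE_lin h [dotv y k]dotvC /schur -/b [dotv b k]dotvC; ring.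
Qed.

(** Law of total covariance: the inverse of [K2] is the covariance given the first coordinate, whose
    variance is 1/[schur], and [s1 - dotv x b] is its coefficient in the conditional mean of the
    linear form (s1, x). *)
Lemma dotv_invmx_schur (s1 t : R) (x y : 'cV[R]_p) : K \in unitmx -> schur != 0 ->
  dotv (col_mx s1%:M x) (invmx K *m col_mx t%:M y) =
  dotv x (invmx K2 *m y) + (s1 - dotv x b) * (t - dotv y b) / schur.
Proof.
move=> Ku s0; pose c := (t - dotv y b) / schur.
have -> : invmx K *m col_mx t%:M y = col_mx c%:M (invmx K2 *m y - c *: b).
  rewrite -[RHS](mulKmx Ku); congr (_ *m _); rewrite mul_block_col_mx.
  rewrite mulmxBr -scalemxAr [K2 *m b]mulKVmx // mulKVmx // [_ + (y - _)]addrC subrK; congr (col_mx _%:M _).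
  have -> : dotv k (invmx K2 *m y - c *: b) = dotv y b - c * dotv k b.
    by rewrite dotvDr dotvNr dotvZr dotv_mulmx trmx_inv K2T [dotv y _]dotvC.
  have -> : a * c + (dotv y b - c * dotv k b) = schur * c + dotv y b by rewrite /schur; ring.
  by rewrite /c mulrC divfK // subrK.
by rewrite dotv_col_mx dotv_scalar_mx dotvDr dotvNr dotvZr /c; ring.
Qed.
End Schur.

(** * Determinant and inverse of a positive definite matrix *)

Section Posdef.
Context (R : realType).

Lemma posdef_det_gt0 p (K : 'M[R]_p) : posdef K -> 0 < \det K.
Proof.
elim: p K => [|p IH] K Kpd; first by rewrite det_mx00.
have [a [k [K2 [EK K2T]]]] := @sym_block_mx _ p K (proj1 Kpd).
move: Kpd; rewrite EK => Kpd; have K2pd := posdef_block_corner Kpd.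
have d2 := IH _ K2pd.
have K2u : K2 \in unitmx by rewrite unitmxE unitfE gt_eqF.
by rewrite det_schur // mulr_gt0 // posdef_schur_gt0.
Qed.

Lemma posdef_unitmx p (K : 'M[R]_p) : posdef K -> K \in unitmx.
Proof. by move=> h; rewrite unitmxE unitfE gt_eqF // posdef_det_gt0. Qed.

Lemma posdef_invmx p (K : 'M[R]_p) : posdef K -> posdef (invmx K).
Proof.
move=> Kpd; have Ku := posdef_unitmx Kpd; case: Kpd => KT Kpos.
split; first by rewrite trmx_inv KT.
move=> v v0; have := Kpos (invmx K *m v).
rewrite mulKVmx // dotvC; apply.
by apply: contra v0 => /eqP/(congr1 (mulmx K)); rewrite mulKVmx // mulmx0 => ->.
Qed.
End Posdef.

(** * Moments of a multivariate Gaussian *)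

Section GaussianMoments.
Context (R : realType).

Definition gauss_exp p (K : 'M[R]_p) (m x : 'cV[R]_p) : R :=
  expR (- (dotv (x - m) (K *m (x - m))) / 2).

Lemma Rint_vecS p (g : 'cV[R]_(1 + p) -> R) :
  Rint_vec g = Rint (fun t => Rint_vec (fun y : 'cV[R]_p => g (col_mx t%:M y))).
Proof.
rewrite /Rint_vec /=; congr Rint; apply/funext => t; congr iter_int.
apply/funext => x; congr g; apply/matrixP => i j; rewrite !mxE.
case: splitP => i' -> ; rewrite mxE; last by rewrite add1n.
by rewrite !ord1 eqxx.
Qed.

(* This space of polynomials is stable under integrating out all the coordinates but
   the first, which is what the induction on the dimension needs, and it contains
   every integrand of the model. *)
Lemma Rint_vec_gauss_moment p (K : 'M[R]_p) (m u v : 'cV[R]_p)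
    (c0 c1 c2 c3 c4 d0 d1 : R) : posdef K ->
  Rint_vec (fun x => (c0 + c1 * dotv u (x - m) + c2 * dotv u (x - m) ^+ 2
     + c3 * dotv u (x - m) ^+ 3 + c4 * dotv u (x - m) ^+ 4
     + (d0 + d1 * dotv u (x - m)) * dotv v (x - m)) * gauss_exp K m x) =
  (c0 + c2 * dotv u (invmx K *m u) + 3 * c4 * dotv u (invmx K *m u) ^+ 2
   + d1 * dotv u (invmx K *m v)) * Num.sqrt ((pi *+ 2) ^+ p / \det K).
Proof.
elim: p K m u v c0 c1 c2 c3 c4 d0 d1 => [|p IH] K m u v c0 c1 c2 c3 c4 d0 d1 Kpd.
  rewrite /Rint_vec /= /gauss_exp !dotvE !big_ord0 det_mx00 expr0 divr1 sqrtr1.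
  by rewrite oppr0 mul0r expR0; ring.
have [a [k [K2 [EK K2T]]]] := @sym_block_mx _ p K (proj1 Kpd).
move: Kpd; rewrite EK => Kpd.
have K2pd := posdef_block_corner Kpd.
have K2u := posdef_unitmx K2pd; have Ku := posdef_unitmx Kpd.
have s0 := posdef_schur_gt0 K2u Kpd.
have sN0 : schur a k K2 != 0 by rewrite gt_eqF.
rewrite Rint_vecS det_schur //.
rewrite -(vsubmxK (m : 'cV[R]_(1 + p))) -(vsubmxK (u : 'cV[R]_(1 + p))) -(vsubmxK (v : 'cV[R]_(1 + p))).
move: (usubmx _) (dsubmx _) => u1 u2; move: (usubmx _) (dsubmx _) => m1 m2.
move: (usubmx _) (dsubmx _) => v1 v2.
rewrite (mx11_scalar m1) (mx11_scalar u1) (mx11_scalar v1).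
move: (m1 0 0) (u1 0 0) (v1 0 0) => {}m1 {}u1 {}v1.
rewrite !dotv_invmx_schur //.
set s := schur a k K2; set b := invmx K2 *m k.
set A := u1 - dotv u2 b; set B := v1 - dotv v2 b.
set N := Num.sqrt ((pi *+ 2) ^+ p / \det K2).
set sg := dotv u2 (invmx K2 *m u2); set om := dotv u2 (invmx K2 *m v2).
(* Given the first coordinate t, the forms in u and v have means [A * (t - m1)] and [B * (t - m1)],
   the first has variance [sg], and their covariance is [om]. Expanding the powers around these
   means and averaging gives the coefficients; [N] is the mass of the conditional weight. *)
transitivity (Rint (fun t =>
  (N * (c0 + c2 * sg + 3 * c4 * sg ^+ 2 + d1 * om)
   + N * (c1 * A + d0 * B + 3 * c3 * A * sg) * (t - m1)
   + N * (c2 * A ^+ 2 + d1 * A * B + 6 * c4 * A ^+ 2 * sg) * (t - m1) ^+ 2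
   + N * (c3 * A ^+ 3) * (t - m1) ^+ 3
   + N * (c4 * A ^+ 4) * (t - m1) ^+ 4) * gauss_weight s m1 t)); last first.
  have -> : Num.sqrt ((pi *+ 2) ^+ p.+1 / (s * \det K2)) = Num.sqrt (pi *+ 2 / s) * N.
    rewrite exprS -mulf_div sqrtrM // divr_ge0 ?(ltW s0) // mulrn_wge0 //.
    exact: pi_ge0.
  by rewrite Rint_quartic_gauss //; field.
congr Rint; apply/funext => t.
set tau := t - m1; set h := A * tau; set E := gauss_weight s m1 t.
(* Conditional mean of the last coordinates given that the first one is t. *)
pose m2' := m2 - tau *: b.
transitivity (Rint_vec (fun y : 'cV[R]_p =>
  (E * (c0 + c1 * h + c2 * h ^+ 2 + c3 * h ^+ 3 + c4 * h ^+ 4 + (d0 + d1 * h) * (B * tau))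
   + E * (c1 + 2 * c2 * h + 3 * c3 * h ^+ 2 + 4 * c4 * h ^+ 3 + d1 * (B * tau)) * dotv u2 (y - m2')
   + E * (c2 + 3 * c3 * h + 6 * c4 * h ^+ 2) * dotv u2 (y - m2') ^+ 2
   + E * (c3 + 4 * c4 * h) * dotv u2 (y - m2') ^+ 3
   + E * c4 * dotv u2 (y - m2') ^+ 4
   + (E * (d0 + d1 * h) + E * d1 * dotv u2 (y - m2')) * dotv v2 (y - m2'))
  * gauss_exp K2 m2' y)); last first.
  by rewrite IH // -/sg -/om -/N /h; ring.
congr Rint_vec; apply/funext => y.
have -> : col_mx t%:M y - col_mx m1%:M m2 = col_mx tau%:M (y - m2) :> 'cV[R]_(1 + p).
  by rewrite opp_col_mx add_col_mx -raddfB.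
rewrite /gauss_exp.
have -> : col_mx t%:M y - col_mx m1%:M m2 = col_mx tau%:M (y - m2) :> 'cV[R]_(1 + p).
  by rewrite opp_col_mx add_col_mx -raddfB.
have dotv_cons (e f : R) (x z : 'cV[R]_p) :
    @dotv R p.+1 (col_mx e%:M x) (col_mx f%:M z) = e * f + dotv x z.
  by rewrite (@dotv_col_mx R 1 p) dotv_scalar_mx.
rewrite dotv_schur // -/b -/s !dotv_cons.
have er : y - m2 + tau *: b = y - m2' by rewrite /m2' opprB addrA addrAC.
rewrite er (_ : y - m2 = (y - m2') - tau *: b); last by rewrite -er addrK.
set r := y - m2'.
have -> : expR (- (s * tau ^+ 2 + dotv r (K2 *m r)) / 2) = E * expR (- dotv r (K2 *m r) / 2).
  by rewrite /E /gauss_weight -expRD; congr expR; rewrite /tau; field.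
rewrite !dotvDr !dotvNr !dotvZr /h /A /B; ring.
Qed.
End GaussianMoments.

(** * Rank-one perturbations *)

Section RankOne.
Context (R : realType) (p : nat).
Implicit Types (M : 'M[R]_p) (u v x : 'cV[R]_p).

Lemma outer_mxE u v i j : (u *m v^T) i j = u i 0 * v j 0.
Proof. by rewrite mxE big_ord1 mxE. Qed.

Lemma mul_outer_mx u v x : (u *m v^T) *m x = dotv v x *: u.
Proof. by rewrite -mulmxA [v^T *m x]mx11_scalar mul_mx_scalar. Qed.

Lemma det_sub_outer M u v : M \in unitmx ->
  \det (M - u *m v^T) = \det M * (1 - dotv v (invmx M *m u)).
Proof.
move=> Mu.
(* Both sides factor the matrix with rows (1, v^T) and (u, M). *)
have e : block_mx (1%:M : 'M[R]_1) 0 u 1%:M *m block_mx 1%:M (v^T) 0 (M - u *m v^T) =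
    block_mx ((1 - dotv v (invmx M *m u))%:M) (v^T) 0 M *m block_mx 1%:M 0 (invmx M *m u) 1%:M.
  rewrite !mulmx_block !mulmx1 !mul1mx !mul0mx !mulmx0 !addr0 !add0r mulKVmx //.
  rewrite [u *m _ + _]addrC subrK; congr block_mx.
  rewrite [v^T *m _]mx11_scalar -/(dotv v _) -raddfD /=; congr (_%:M).
  by rewrite subrK.
move/(congr1 determinant): e.
by rewrite !det_mulmx !det_lblock !det_ublock !det1 det_scalar1 !mul1r !mulr1 mulrC.
Qed.

Lemma det_add_outer M u (a : R) : M \in unitmx ->
  \det (M + a *: (u *m u^T)) = \det M * (1 + a * dotv u (invmx M *m u)).
Proof.
move=> Mu; have := det_sub_outer (- a *: u) u Mu.
by rewrite -scalemxAl -scalemxAr dotvZr scaleNr mulNr !opprK.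
Qed.

Lemma posdef_add_outer M u (a : R) : posdef M -> 0 <= a ->
  posdef (M + a *: (u *m u^T)).
Proof.
case=> MT Mpos a0; split; first by rewrite linearD linearZ /= MT trmx_mul trmxK.
move=> v v0; rewrite mulmxDl -scalemxAl mul_outer_mx dotvDr !dotvZr.
rewrite ltr_wpDr ?Mpos // mulr_ge0 //.
by rewrite [dotv v u]dotvC -expr2 sqr_ge0.
Qed.

(** Sherman-Morrison formula, applied to a vector. *)
Lemma invmx_add_outer M u (a : R) x : M \in unitmx ->
  1 + a * dotv u (invmx M *m u) != 0 ->
  invmx (M + a *: (u *m u^T)) *m x =
  invmx M *m x - (a * dotv u (invmx M *m x) / (1 + a * dotv u (invmx M *m u))) *: (invmx M *m u).
Proof.
move=> Mu d0; set N := M + _.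
have Nu : N \in unitmx.
  by rewrite unitmxE det_add_outer // unitfE mulf_neq0 // -unitfE -unitmxE.
rewrite -[RHS](mulKmx Nu); congr (_ *m _).
rewrite /N mulmxDl !mulmxBr -!scalemxAl -!scalemxAr !mul_outer_mx !mulKVmx //.
set q := dotv u (invmx M *m u) in d0 *; set r := dotv u (invmx M *m x).
rewrite !scalerA -scalerBl -addrA -scaleNr -scalerDl.
by rewrite [X in X *: u](_ : _ = 0) ?scale0r ?addr0 //; field.
Qed.

(** The determinant lemma is applied twice; Sherman-Morrison for the inner perturbation produces the
    cross term. Only d needs a sign, to keep that inner matrix invertible. *)
Lemma det_add_outer2 M u v (a d : R) : posdef M -> 0 <= d ->
  \det (M + d *: (v *m v^T) + a *: (u *m u^T)) =
  \det M * ((1 + a * dotv u (invmx M *m u)) * (1 + d * dotv v (invmx M *m v))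
            - a * d * dotv v (invmx M *m u) ^+ 2).
Proof.
move=> Mpd d0; have Mu := posdef_unitmx Mpd.
have q0 : 0 <= dotv v (invmx M *m v).
  have [->|v0] := eqVneq v 0; first by rewrite dotv0l.
  by apply/ltW; case: (posdef_invmx Mpd) => _; apply.
have q1 : 1 + d * dotv v (invmx M *m v) != 0.
  by rewrite gt_eqF // ltr_wpDr // mulr_ge0.
have sym : dotv u (invmx M *m v) = dotv v (invmx M *m u).
  by rewrite dotv_mulmx trmx_inv (proj1 Mpd) dotvC.
rewrite det_add_outer; last first.
  by rewrite unitmxE det_add_outer // unitfE mulf_neq0 // -unitfE -unitmxE.
by rewrite det_add_outer // invmx_add_outer // dotvDr dotvNr dotvZr sym; field.
Qed.
End RankOne.

(** * The same moments for normalised densities *)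

Section GaussianLaws.
Context (R : realType).

Lemma Rint_quartic_normal (m s c0 c1 c2 c3 c4 : R) : 0 < s ->
  Rint (fun t => (c0 + c1 * (t - m) + c2 * (t - m) ^+ 2 + c3 * (t - m) ^+ 3 + c4 * (t - m) ^+ 4)
                 * normal_pdf m s t) = c0 + c2 * s ^+ 2 + 3 * c4 * s ^+ 4.
Proof.
move=> s0; have k0 : 0 < (s ^+ 2)^-1 by rewrite invr_gt0 exprn_gt0.
pose P := Num.sqrt (pi *+ 2 / (s ^+ 2)^-1).
have P0 : P != 0.
  by rewrite gt_eqF // sqrtr_gt0 divr_gt0 // mulrn_wgt0 // pi_gt0.
have nE t : normal_pdf m s t = P^-1 * gauss_weight (s ^+ 2)^-1 m t.
  rewrite gauss_weight_normal // -/P mulKf // invrK.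
  by rewrite sqrtr_sqr gtr0_norm.
transitivity (Rint (fun t => (P^-1 * c0 + P^-1 * c1 * (t - m) + P^-1 * c2 * (t - m) ^+ 2
    + P^-1 * c3 * (t - m) ^+ 3 + P^-1 * c4 * (t - m) ^+ 4) * gauss_weight (s ^+ 2)^-1 m t)).
  by congr Rint; apply/funext => t; rewrite nE; ring.
by rewrite Rint_quartic_gauss // -/P; field; rewrite P0 gt_eqF.
Qed.

Lemma Rint_vec_mvn_moment p (S : 'M[R]_p) (m u v : 'cV[R]_p)
    (c0 c1 c2 c3 c4 d0 d1 : R) : posdef S ->
  Rint_vec (fun x => (c0 + c1 * dotv u (x - m) + c2 * dotv u (x - m) ^+ 2
     + c3 * dotv u (x - m) ^+ 3 + c4 * dotv u (x - m) ^+ 4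
     + (d0 + d1 * dotv u (x - m)) * dotv v (x - m)) * mvn_pdf m S x) =
  c0 + c2 * dotv u (S *m u) + 3 * c4 * dotv u (S *m u) ^+ 2 + d1 * dotv u (S *m v).
Proof.
move=> Spd; have Su := posdef_unitmx Spd.
pose P := Num.sqrt ((pi *+ 2) ^+ p * \det S).
have P0 : P != 0.
  by rewrite gt_eqF // sqrtr_gt0 mulr_gt0 ?posdef_det_gt0 // exprn_gt0 // mulrn_wgt0 // pi_gt0.
transitivity (Rint_vec (fun x => (P^-1 * c0 + P^-1 * c1 * dotv u (x - m)
     + P^-1 * c2 * dotv u (x - m) ^+ 2
     + P^-1 * c3 * dotv u (x - m) ^+ 3 + P^-1 * c4 * dotv u (x - m) ^+ 4
     + (P^-1 * d0 + P^-1 * d1 * dotv u (x - m)) * dotv v (x - m)) * gauss_exp (invmx S) m x)).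
  by congr Rint_vec; apply/funext => x; rewrite /mvn_pdf -/P /gauss_exp; ring.
rewrite Rint_vec_gauss_moment; last exact: posdef_invmx.
by rewrite invmxK det_inv invrK -/P; field.
Qed.
End GaussianLaws.

(** * Closed forms of the matrices of the model *)

Section Model.
Context (R : realType) (p : nat).
Variables (b mu : 'cV[R]_p) (S : 'M[R]_p) (s : R).
Hypotheses (s0 : 0 < s) (Spd : posdef S).

Let c := S *m b.
Let t2 := dotv b c.
Let V := s ^+ 2 + t2.
Let m := dotv b mu.

Lemma posdef_dotv_ge0 (v : 'cV[R]_p) : 0 <= dotv v (S *m v).
Proof.
have [->|v0] := eqVneq v 0; first by rewrite dotv0l.
by apply/ltW; case: Spd => _; apply.
Qed.

Let sN0 : s != 0. Proof. by rewrite gt_eqF. Qed.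
Let V0 : 0 < V. Proof. by rewrite ltr_wpDr ?posdef_dotv_ge0 // exprn_gt0. Qed.
Let VN0 : V != 0. Proof. by rewrite gt_eqF. Qed.
Let Su : S \in unitmx. Proof. exact: posdef_unitmx. Qed.
Let ST : S^T = S. Proof. by case: Spd. Qed.

(* The law of X given Y = y is Gaussian with precision cond_prec and mean cond_mean y. *)
Let cond_prec := invmx S + (s ^+ 2)^-1 *: (b *m b^T).
Let cond_cov := invmx cond_prec.
Let cond_mean (y : R) := mu + ((y - m) / V) *: c.

Let e0 : 1 + (s ^+ 2)^-1 * t2 != 0.
Proof. by rewrite gt_eqF // ltr_wpDr // mulr_ge0 ?posdef_dotv_ge0 // invr_ge0 sqr_ge0. Qed.

Lemma posdef_cond_prec : posdef cond_prec.
Proof.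
by apply: posdef_add_outer (posdef_invmx Spd) _; rewrite invr_ge0 sqr_ge0.
Qed.

Lemma det_cond_cov : \det cond_cov = \det S * (s ^+ 2 / V).
Proof.
rewrite det_inv det_add_outer ?unitmx_inv // invmxK det_inv -/c -/t2.
have d0 : \det S != 0 by rewrite -unitfE -unitmxE.
by rewrite /V; field; rewrite d0 sN0 /= -/V VN0.
Qed.

Lemma mul_cond_cov x : cond_cov *m x = S *m x - (dotv c x / V) *: c.
Proof.
rewrite /cond_cov invmx_add_outer ?unitmx_inv // invmxK //.
congr (_ - _ *: _); rewrite -/c -/t2 dotv_mulmx ST -/c.
by rewrite /V; field; rewrite sN0 /= -/V VN0.
Qed.

(** Both sides are the joint density of (X, Y). Afterwards every integral over x at fixed y is a
    moment of the conditional law. *)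
Lemma normal_mul_mvn_pdf y x :
  fnoise s (y - dotv b x) * mvn_pdf mu S x =
  normal_pdf m (Num.sqrt V) y * mvn_pdf (cond_mean y) cond_cov x.
Proof.
have sV : Num.sqrt V != 0 by rewrite gt_eqF // sqrtr_gt0.
rewrite /fnoise !normal_pdfE // /normal_peak /normal_fun /mvn_pdf sqr_sqrtr ?(ltW V0) //.
rewrite [LHS]mulrACA [RHS]mulrACA -!expRD; congr (_ * expR _).
  have h (q : R) : 0 <= q -> 0 <= q * pi *+ 2 by move=> q0; rewrite mulrn_wge0 // mulr_ge0 // pi_ge0.
  rewrite -!invfM -!sqrtrM ?h ?sqr_ge0 ?(ltW V0) // det_cond_cov.
  by congr (Num.sqrt _)^-1; field.
rewrite /cond_cov invmxK.
set r := x - mu; set e := y - m.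
have -> : x - cond_mean y = r - (e / V) *: c by rewrite /cond_mean opprD addrA.
have -> : y - dotv b x - 0 = e - dotv b r by rewrite subr0 /e /r dotvDr dotvNr -/m; ring.
clearbody r; rewrite /cond_prec mulmxDl -scalemxAl mul_outer_mx [invmx S *m (r - _)]mulmxBr -scalemxAr mulKmx //.
have cr : dotv c (invmx S *m r) = dotv b r by rewrite dotv_mulmx trmx_inv ST mulKmx.
rewrite !dotvE_lin cr [dotv r b]dotvC [dotv c b]dotvC -/t2.
move: (dotv r _) (dotv b r) => rKr br.
by rewrite /V; field; rewrite -/V VN0.
Qed.

Lemma dotv_delta (i : 'I_p) (x : 'cV[R]_p) : dotv (delta_mx i 0) x = x i 0.
Proof.
rewrite dotvE (bigD1 i) //= mxE !eqxx mul1r big1 ?addr0 // => j ji.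
by rewrite mxE (negbTE ji) mul0r.
Qed.

Lemma fYE y : fY b mu S s y = normal_pdf m (Num.sqrt V) y.
Proof.
rewrite /fY /fX; under eq_fun do rewrite normal_mul_mvn_pdf.
set P := normal_pdf _ _ _.
(* This pattern recurs below: supplying the coefficients leaves the pointwise match of the integrand
   and the simplification of the value. *)
apply: etrans (etrans _ (Rint_vec_mvn_moment (cond_mean y) 0 0 P 0 0 0 0 0 0
  (posdef_invmx posdef_cond_prec))) _; last by ring.
by congr Rint_vec; apply/funext => x; rewrite -/cond_cov; ring.
Qed.

Lemma fnoise'E t : fnoise' s t = - (t / s ^+ 2) * fnoise s t.
Proof.
rewrite /fnoise' /fnoise derive1E.
have -> : normal_pdf 0 s = normal_peak s \*: (fun t => (t - 0) ^+ 0 * gauss_weight (s ^+ 2)^-1 0 t).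
  apply/funext => x; rewrite normal_pdfE //= expr0 mul1r; congr (_ * expR _).
  by rewrite mulNr; field.
have [_ ->] := is_deriveZ (normal_peak s) (is_derive_monomial_gauss (s ^+ 2)^-1 0 0 t).
by rewrite /= subr0 expr0 expr1 -[LHS]/(_ * _) -[X in _ = _ * X]/(_ * _); field.
Qed.

(** The value is the derivative in y of [fY] times the i-th entry of [cond_mean y]. Instead of
    differentiating under the integral, the proof computes a second moment of the conditional
    law. *)
Lemma hvecE y (i : 'I_p) : hvec b mu S s y i 0 =
  normal_pdf m (Num.sqrt V) y / V * (c i 0 - (y - m) * (mu i 0 + (y - m) / V * c i 0)).
Proof.
rewrite mxE; set P := normal_pdf _ _ _; set my := cond_mean y.
set k := (y - m) / V.
have mym : dotv b my = m + k * t2 by rewrite /my dotvDr dotvZr.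
have myi : my i 0 = mu i 0 + k * c i 0 by rewrite /my !mxE.
have nm x : fnoise s (y - dotv b x) * mvn_pdf mu S x = P * mvn_pdf my cond_cov x.
  exact: normal_mul_mvn_pdf.
clearbody my; have Pcov := posdef_invmx posdef_cond_prec.
(* With w = [dotv b (x - my)], the residual is y - b.my - w and the i-th entry of x is that of [my]
   plus a centred form; the coefficients expand their product. *)
apply: etrans (etrans _ (Rint_vec_mvn_moment my b (delta_mx i 0)
  (- P / s ^+ 2 * (y - dotv b my) * my i 0) (P / s ^+ 2 * my i 0) 0 0 0
  (- P / s ^+ 2 * (y - dotv b my)) (P / s ^+ 2) Pcov)) _.
  congr Rint_vec; apply/funext => x; rewrite mxE fnoise'E /fX.
  have -> (q1 q2 q3 q4 : R) : - q1 * q2 * q3 * q4 = - q1 * (q2 * q3) * q4 by ring.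
  rewrite nm -/cond_cov !dotv_delta !dotvDr !dotvNr !mxE.
  by field.
rewrite -/cond_cov !mul_cond_cov !dotvDr !dotvNr !dotvZr.
have -> : dotv c (delta_mx i 0) = c i 0 by rewrite dotvC dotv_delta.
have -> : dotv b (S *m delta_mx i 0) = c i 0 by rewrite dotv_mulmx ST dotvC dotv_delta.
rewrite -/c -/t2 mym myi.
by rewrite /k /V; field; rewrite -/V VN0 sN0.
Qed.

Lemma Gamma1E : Gamma1 b mu S s = V^-1 *: (mu *m mu^T) + (2 / V ^+ 2) *: (c *m c^T).
Proof.
have V4 : Num.sqrt V ^+ 4 = V ^+ 2 by rewrite (exprM _ 2 2) sqr_sqrtr // ltW.
have sV0 : 0 < Num.sqrt V by rewrite sqrtr_gt0.
apply/matrixP => i j; rewrite mxE [RHS]mxE [X in X + _]mxE [X in _ + X]mxE !outer_mxE.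
move: (mu i 0) (mu j 0) (c i 0) (c j 0) (hvecE ^~ i) (hvecE ^~ j) => mi mj ci cj hi hj.
(* One factor [fY] cancels, leaving the density of Y times a quartic in y - m. The degrees 0, 2 and
   4 contribute 1 - 2 + 3 = 2 to the c c^T term. *)
apply: etrans (etrans _ (Rint_quartic_normal m (ci * cj / V ^+ 2)
  (- (ci * mj + cj * mi) / V ^+ 2) ((mi * mj - 2 * ci * cj / V) / V ^+ 2)
  ((mi * cj + mj * ci) / V / V ^+ 2) (ci * cj / V ^+ 4) sV0)) _.
  congr Rint; apply/funext => y; rewrite mxE outer_mxE hi hj fYE.
  have : normal_pdf m (Num.sqrt V) y != 0.
    by rewrite gt_eqF // normal_pdfE ?gt_eqF // mulr_gt0 ?expR_gt0 // normal_peak_gt0 ?gt_eqF.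
  by move: (normal_pdf _ _ _) => P P0; field; rewrite P0 VN0.
by rewrite V4 sqr_sqrtr ?(ltW V0) //; field.
Qed.

Lemma vvecE x (i : 'I_p) : vvec b mu S s x i 0 =
  (c i 0 * (t2 - dotv b (x - mu) ^+ 2) / V - dotv b (x - mu) * mu i 0) / V.
Proof.
have sV0 : 0 < Num.sqrt V by rewrite sqrtr_gt0.
rewrite mxE; set w := dotv b (x - mu).
have wE : w = dotv b x - m by rewrite /w dotvDr dotvNr.
move: (mu i 0) (c i 0) (hvecE ^~ i) => mi ci hi.
(* Given X = x, Y is N(b.x, s^2), so y - m is re-expanded as (y - b.x) + w; the [t2] of the value is
   V - s^2. *)
apply: etrans (etrans _ (Rint_quartic_normal (dotv b x) ((ci - w * mi - w ^+ 2 / V * ci) / V)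
   (- (mi + 2 * w * ci / V) / V) (- ci / V ^+ 2) 0 0 s0)) _.
  congr Rint; apply/funext => y; rewrite mxE hi fYE.
  have : normal_pdf m (Num.sqrt V) y != 0.
    by rewrite gt_eqF // normal_pdfE ?gt_eqF // mulr_gt0 ?expR_gt0 // normal_peak_gt0 ?gt_eqF.
  have -> : fnoise s (y - dotv b x) = normal_pdf (dotv b x) s y.
    by rewrite /fnoise !normal_pdfE // /normal_fun subr0.
  by move: (normal_pdf m _ _) => P P0; rewrite wE; field; rewrite P0 VN0.
by rewrite /V; field; rewrite -/V VN0.
Qed.

Lemma Gamma2E : Gamma2 b mu S s =
  (t2 / V ^+ 2) *: (mu *m mu^T) + (2 * t2 ^+ 2 / V ^+ 4) *: (c *m c^T).
Proof.
apply/matrixP => i j; rewrite mxE [RHS]mxE [X in X + _]mxE [X in _ + X]mxE !outer_mxE.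
move: (mu i 0) (mu j 0) (c i 0) (c j 0) (vvecE ^~ i) (vvecE ^~ j) => mi mj ci cj hi hj.
apply: etrans (etrans _ (Rint_vec_mvn_moment mu b 0 (ci * cj * t2 ^+ 2 / V ^+ 4)
  (- (ci * mj + cj * mi) * t2 / V ^+ 3) ((mi * mj - 2 * ci * cj * t2 / V ^+ 2) / V ^+ 2)
  ((ci * mj + cj * mi) / V ^+ 3) (ci * cj / V ^+ 4) 0 0 Spd)) _.
  congr Rint_vec; apply/funext => x; rewrite mxE outer_mxE hi hj /fX.
  by field.
by rewrite -/c -/t2; field.
Qed.

Lemma EXXtE : EXXt mu S = S + mu *m mu^T.
Proof.
apply/matrixP => i j; rewrite mxE [RHS]mxE outer_mxE.
apply: etrans (etrans _ (Rint_vec_mvn_moment mu (delta_mx i 0) (delta_mx j 0)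
  (mu i 0 * mu j 0) (mu j 0) 0 0 0 (mu i 0) 1 Spd)) _.
  by congr Rint_vec; apply/funext => x; rewrite mxE outer_mxE /fX !dotv_delta !mxE; ring.
by rewrite !dotv_delta -!colE !mxE; ring.
Qed.

Lemma fisher_fnoise : Rint (fun t => fnoise' s t ^+ 2 / fnoise s t) = (s ^+ 2)^-1.
Proof.
apply: etrans (etrans _ (Rint_quartic_normal 0 0 0 (s ^+ 4)^-1 0 0 s0)) _.
  congr Rint; apply/funext => t; rewrite fnoise'E /fnoise.
  have : normal_pdf 0 s t != 0.
    by rewrite gt_eqF // normal_pdfE // mulr_gt0 ?expR_gt0 // normal_peak_gt0.
  by move: (normal_pdf _ _ _) => P P0; field; rewrite P0 sN0.
by field.
Qed.

End Model.

(** * The gain as a ratio of determinants *)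

Section Gain.
Context (R : realType) (p : nat).
Variables (b mu : 'cV[R]_p) (S : 'M[R]_p) (s lam : R).
Hypotheses (s0 : 0 < s) (Spd : posdef S) (lam0 : 0 < lam).

Let t2 := dotv b (S *m b).
Let V := s ^+ 2 + t2.
Let m := dotv b mu.
Let q := dotv mu (invmx S *m mu).
Let info (d a : R) := S + d *: (mu *m mu^T) + a *: ((S *m b) *m (S *m b)^T).
Let info_det (d a : R) := (1 + a * t2) * (1 + d * q) - a * d * m ^+ 2.
(* Up to the factor s^-2, Sigma2 is info 1 0, Amat is info dA aA and Bmat is info dB aB. *)
Let dA := 1 + s ^+ 2 / (lam * V).
Let aA := 2 * s ^+ 2 / (lam * V ^+ 2).
Let dB := 1 + s ^+ 2 / lam * (V^-1 + t2 / V ^+ 2).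
Let aB := s ^+ 2 / lam * (2 / V ^+ 2 + 2 * t2 ^+ 2 / V ^+ 4).

Let t20 : 0 <= t2. Proof. exact: posdef_dotv_ge0. Qed.
Let s2 : 0 < s ^+ 2. Proof. exact: exprn_gt0. Qed.
Let V0 : 0 < V. Proof. by rewrite ltr_wpDr. Qed.

Lemma det_info d a : 0 <= d -> \det (info d a) = \det S * info_det d a.
Proof.
move=> d0; rewrite det_add_outer2 // mulKmx ?posdef_unitmx //.
by rewrite [dotv (S *m b) b]dotvC [dotv mu b]dotvC.
Qed.

Lemma posdef_info d a : 0 <= d -> 0 <= a -> posdef (info d a).
Proof. by move=> d0 a0; do 2!apply: posdef_add_outer => //. Qed.

Lemma gainE : gain b mu S s lam =
  info_det dA aA / (1 + q) / Num.sqrt (info_det dB aB / (1 + q)).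
Proof.
have VN0 : V != 0 by rewrite gt_eqF.
have lN0 : lam != 0 by rewrite gt_eqF.
have sN0 : s != 0 by rewrite gt_eqF.
have e2 : Sigma2 mu S s = (s ^+ 2)^-1 *: info 1 0.
  by rewrite /Sigma2 fisher_fnoise // EXXtE // /info scale1r scale0r addr0.
have eA : Amat b mu S s lam = (s ^+ 2)^-1 *: info dA aA.
  rewrite /Amat e2 Gamma1E // /info -/t2 -/V.
  apply/matrixP => i j; rewrite !mxE; move: (\sum_k _) (\sum_k _) (S i j) => x1 x2 x3.
  by rewrite /dA /aA; field; rewrite lN0 VN0 sN0.
have eB : Bmat b mu S s lam = (s ^+ 2)^-1 *: info dB aB.
  rewrite /Bmat e2 Gamma1E // Gamma2E // /info -/t2 -/V.
  apply/matrixP => i j; rewrite !mxE; move: (\sum_k _) (\sum_k _) (S i j) => x1 x2 x3.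
  by rewrite /dB /aB; field; rewrite lN0 VN0 sN0.
have dA0 : 0 <= dA by rewrite addr_ge0 // divr_ge0 ?mulr_ge0 // ltW.
have aA0 : 0 <= aA by rewrite divr_ge0 ?mulr_ge0 ?sqr_ge0 // ltW.
have dB0 : 0 <= dB.
  rewrite addr_ge0 // mulr_ge0 ?divr_ge0 ?sqr_ge0 ?(ltW lam0) //.
  by rewrite addr_ge0 ?invr_ge0 ?divr_ge0 ?sqr_ge0 // ltW.
have S0 := posdef_det_gt0 Spd.
have SN0 : \det S != 0 by rewrite gt_eqF.
have DA : 0 < info_det dA aA.
  by have := posdef_det_gt0 (posdef_info dA0 aA0); rewrite det_info // pmulr_rgt0.
have q1 : 0 < 1 + q.
  rewrite ltr_wpDr //; exact: posdef_dotv_ge0 (posdef_invmx Spd) _.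
have D2 : info_det 1 0 = 1 + q by rewrite /info_det; ring.
have k0 : (s ^+ 2)^-1 ^+ p != 0 by rewrite expf_neq0 // invr_neq0 // gt_eqF.
rewrite /gain /Sigma_SSL /Sigma_OLS eA eB e2 !det_mulmx !det_inv !detZ !det_info // D2.
(* The powers of s^2 and the determinants of [S] cancel. The square is isolated so that the root
   extracts its base, whose sign is known from [DA] and [q1]. *)
have -> : ((s ^+ 2)^-1 ^+ p * (\det S * info_det dA aA))^-1 *
   ((s ^+ 2)^-1 ^+ p * (\det S * info_det dB aB)) *
   ((s ^+ 2)^-1 ^+ p * (\det S * info_det dA aA))^-1 /
   ((s ^+ 2)^-1 ^+ p * (\det S * (1 + q)))^-1 =
   ((1 + q) / info_det dA aA) ^+ 2 * (info_det dB aB / (1 + q)).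
  by field; rewrite k0 SN0 !gt_eqF.
rewrite sqrtrM ?sqr_ge0 // sqrtr_sqr gtr0_norm ?divr_gt0 //.
by rewrite invfM invf_div.
Qed.
End Gain.

(** * Maximum likelihood and least squares *)

Section Likelihood.
Context (R : realType) (p n : nat) (s : R).
Variables (X : 'I_n -> 'cV[R]_p) (Y : 'I_n -> R).

(** The log-likelihood is affine in [rss] with negative slope, so the two sets of optimisers agree
    without any rank condition on the design. *)
Lemma loglikE b : s != 0 ->
  loglik s X Y b = n%:R * ln (normal_peak s) - rss X Y b / (s ^+ 2 *+ 2).
Proof.
move=> s0; rewrite /loglik /rss mulr_suml mulr_natl -[n in _ *+ n]card_ord -sumr_const -sumrB.
apply: eq_bigr => k _; rewrite /fnoise normal_pdfE // lnM ?posrE ?expR_gt0 ?normal_peak_gt0 //.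
by rewrite expRK subr0 mulNr.
Qed.

Lemma is_MLE_OLS b : 0 < s -> is_MLE s X Y b <-> is_OLS X Y b.
Proof.
move=> s0; have k0 : 0 < (s ^+ 2 *+ 2)^-1 by rewrite invr_gt0 mulrn_wgt0 // exprn_gt0.
by split=> h b'; have := h b'; rewrite !loglikE ?gt_eqF // lerD2l lerN2 ler_pM2r.
Qed.
End Likelihood.


Theorem theorem3 (R : realType) (p : nat) (lam : R) (beta0 mu : 'cV[R]_p)
  (SX : 'M[R]_p) (s : R) :
  (0 < p)%N -> 0 < lam < 1 -> beta0 != 0 -> 0 < s -> posdef SX ->
  let eta := dotv beta0 (SX *m beta0) / s ^+ 2 in
  let G := gain beta0 mu SX s lam in
  (forall (m : nat) (X : 'I_m -> 'cV[R]_p) (Y : 'I_m -> R) (b : 'cV[R]_p),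
      is_MLE s X Y b <-> is_OLS X Y b) /\
  (mu != 0 ->
   let zeta := dotv mu beta0 /
     (Num.sqrt (dotv beta0 (SX *m beta0)) * Num.sqrt (dotv mu (invmx SX *m mu))) in
   let rho := (dotv mu (invmx SX *m mu))^-1 in
   G =
   (1 + lam^-1 * ((1 + eta)^-1 * (1 + rho)^-1
                  + 2 * eta / (eta + 1) ^+ 2 * (1 - zeta ^+ 2 / (1 + rho)))
      + (lam ^+ 2)^-1 * ((1 - zeta ^+ 2) / (1 + rho)) * (2 * eta / (eta + 1) ^+ 3))
   / Num.sqrt
       (1 + lam^-1 * ((1 + eta)^-1 * (1 + rho)^-1 * (1 + eta / (eta + 1))
                      + 2 * eta / (eta + 1) ^+ 2 * (1 - zeta ^+ 2 / (1 + rho))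
                        * (1 + eta ^+ 2 / (eta + 1) ^+ 2))
          + (lam ^+ 2)^-1 * ((1 - zeta ^+ 2) / (1 + rho)) * (2 * eta / (eta + 1) ^+ 3)
            * (1 + eta ^+ 2 / (eta + 1) ^+ 2) * (1 + eta / (eta + 1)))) /\
  (mu = 0 ->
   G = (1 + 2 / lam * (eta / (eta + 1) ^+ 2))
       / Num.sqrt (1 + 2 / lam * (eta / (eta + 1) ^+ 2 + eta ^+ 3 / (eta + 1) ^+ 4))).
Proof.
move=> _ /andP[lam0 _] b0 s0 Spd eta G.
have s2 : 0 < s ^+ 2 by exact: exprn_gt0.
have sN0 : s != 0 by rewrite gt_eqF.
have lN0 : lam != 0 by rewrite gt_eqF.
have t20 : 0 < dotv beta0 (SX *m beta0) by case: Spd => _; apply.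
have GE := gainE beta0 mu s0 Spd lam0.
split; first by move=> m X Y b; exact: is_MLE_OLS.
move: GE; rewrite -/G /eta; set t2 := dotv beta0 _ in t20 *; clearbody G t2.
have VN0 : t2 + s ^+ 2 != 0 by rewrite gt_eqF // addr_gt0.
split=> [mu0|mu0] /=; move: GE => ->.
- have q0 : 0 < dotv mu (invmx SX *m mu) by case: (posdef_invmx Spd) => _; apply.
  rewrite [dotv beta0 mu]dotvC; move: (dotv mu beta0) (dotv mu _) q0 => m q q0.
  (* Only the square of zeta occurs, so its roots disappear. With rho = 1/q, eta = t2/s^2 and zeta^2
     = m^2/(t2 q), numerator and radicand match separately as rational functions. *)
  rewrite !(exprMn, exprVn) !sqr_sqrtr ?(ltW t20) ?(ltW q0) //.
  have [tN0 qN0 q1] : [/\ t2 != 0, q != 0 & q + 1 != 0].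
    by rewrite !gt_eqF // addr_gt0.
  by congr (_ / Num.sqrt _); field; rewrite lN0 VN0 sN0 tN0 qN0 q1.
(* Here q and m vanish, so only the factors 1 + a t2 of [info_det] remain. *)
- rewrite mu0 dotv0l dotvC dotv0l.
  by congr (_ / Num.sqrt _); field; rewrite lN0 VN0 sN0.
Qed.
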